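(* Suppose that $\mathrm{zer}(\Phi)\neq\emptyset$, $F$ is $L$-Lipschitz continuous, $\Phi$ is $\rho$-co-hypomonotone, and $J_{\eta T}$ is well-defined. Let $\{(x^k,\hat x^k,y^k)\}$ be generated by the scheme (GAEG) described in the context, using $u^k$ with $u^0=Fx^0$ and, for all $k\ge1$, $$\|Fx^k-u^k\|^2\le\kappa\|Fx^k-Fy^{k-1}\|^2+\hat\kappa\|w^k-w^{k-1}\|^2,$$ for some $\kappa\ge0$ and $\hat\kappa\ge0$. Given $r>1$, suppose that $$0\le\hat\kappa\le\frac{r-1}{58r},\qquad L\rho<\frac{6}{29\sqrt{2(5\kappa+1)}},\qquad0<\lambda\le\bar\lambda,\qquad\eta:=4\lambda+\frac{29}{6}\rho,$$ $$t_k:=k+r,\qquad\gamma_k:=\frac{t_k-1}{t_k},\qquad\theta_k:=\frac{t_k-1}{t_{k+1}},\qquad\nu_k:=\frac{t_k}{t_{k+1}},$$ where, with $\sigma:=\frac5{24}$, $$\bar\lambda:=\frac{2\bar c}{\bar b+\sqrt{\bar b^2+4\bar c}},\qquad\bar b:=\frac{(1+\sigma)(49\kappa+8)\rho}{29\kappa+4},\qquad\bar c:=\frac{1-32(1+\sigma)^2(5\kappa+1)L^2\rho^2}{8L^2(29\kappa+4)}.$$ Then, for any $x^\star\in\mathrm{zer}(\Phi)$ and all $k\ge0$, $$\|Fx^k+\xi^k\|^2\le\frac{\mathcal R_0^2}{3\lambda^2(k+r-1)(k+r+2)},$$ where $\mathcal R_0^2:=\lambda(r-1)\big[12(r+2)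\lambda+29\rho\big]\|Fx^0+\xi^0\|^2+16\|x^0-x^\star\|^2$.
   Context: $\mathbb R^p$ carries the standard inner product and Euclidean norm. $F:\mathbb R^p\to\mathbb R^p$ is single-valued, $T:\mathbb R^p\rightrightarrows2^{\mathbb R^p}$ is set-valued, $\Phi:=F+T$, $\mathrm{zer}(\Phi)=\{x:0\in Fx+Tx\}$. For $\rho\ge0$, $\Phi$ is $\rho$-co-hypomonotone if $\langle u-v,x-y\rangle\ge-\rho\|u-v\|^2$ for all $(x,u),(y,v)\in\mathrm{gra}(\Phi)$. $F$ is $L$-Lipschitz continuous if $\|Fx-Fy\|\le L\|x-y\|$ for all $x,y$. The resolvent is $J_{\eta T}x=\{y:x\in y+\eta Ty\}$; ''well-defined'' means $\mathrm{dom}(J_{\eta T})=\mathbb R^p$ and $\mathrm{ran}(J_{\eta T})\subseteq\mathrm{dom}(F)=\mathbb R^p$, and $J_{\eta T}$ is moreover assumed single-valued. Scheme (GAEG): start from $x^0\in\mathrm{dom}(\Phi)$, $\xi^0\in Tx^0$ arbitrary, $u^0:=Fx^0$, $y^{-1}=\hat x^{-1}=\hat x^0:=x^0$, and $y^0=\hat x^0$. With $\xi^k\in Tx^k$ put $w^k:=Fx^k+\xi^k$, $\hat w^k:=Fy^{k-1}+\xi^k$, $z^k:=u^k+\xi^k$. For $k\ge0$: $$x^{k+1}:=y^k-\eta(\hat w^{k+1}-\gamma_kz^k),\qquad\hat x^{k+1}:=x^{k+1}-\lambda z^{k+1},\qquad y^{k+1}:=\hat x^{k+1}+\theta_k(\hat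 x^{k+1}-\hat x^k)+\nu_k(y^k-\hat x^{k+1}),$$ where the first (implicit) line means $x^{k+1}=J_{\eta T}\big(y^k-\eta(Fy^k-\gamma_kz^k)\big)$ and $\xi^{k+1}:=\frac1\eta(y^k-x^{k+1})-Fy^k+\gamma_kz^k\in Tx^{k+1}$. *)

(* Defs.v *)
From mathcomp Require Import all_boot all_order all_algebra.
From mathcomp Require Import mathcomp_extra boolp classical_sets reals.

Set Implicit Arguments.
Unset Strict Implicit.
Unset Printing Implicit Defensive.

Import Order.TTheory GRing.Theory Num.Theory.
Local Open Scope classical_set_scope.
Local Open Scope ring_scope.

Section Euclidean.
Context {R : realType} {p : nat}.
Implicit Types x y : 'rV[R]_p.

Definition inner x y : R := \sum_(i < p) x 0 i * y 0 i.

(* Not the norm `|x| that MathComp-Analysis puts on matrices, which is the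
   sup norm. *)
Definition enorm x : R := Num.sqrt (inner x x).

End Euclidean.

Section Operators.
Context {R : realType} {p : nat}.
Local Notation V := 'rV[R]_p.
Implicit Types (F : V -> V) (T Phi : V -> set V).

Definition lipschitz_with (L : R) F : Prop :=
  forall x y, enorm (F x - F y) <= L * enorm (x - y).

(* A set-valued map V => 2^V is a function V -> set V; its domain is the set
   of the x with a nonempty image, its graph the set of pairs (x, u) with
   [T x u]. *)
Definition sv_dom T : set V := [set x | T x !=set0].

Definition sv_sum F T : V -> set V := fun x => [set F x + v | v in T x].

Definition zer Phi : set V := [set x | Phi x 0].

Definition co_hypomonotone (rho : R) Phi : Prop :=
  forall x u y v, Phi x u -> Phi y v ->
    inner (u - v) (x - y) >= - rho * enorm (u - v) ^+ 2.

Definition resolvent (eta : R) T : V -> set V :=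
  fun x => [set y | exists2 v, T y v & x = y + eta *: v].

(* The requirement that the range of the resolvent be contained in the domain
   of F is automatic, since F is a total function on V. *)
Definition resolvent_well_defined (eta : R) T : Prop :=
  sv_dom (resolvent eta T) = setT /\
  forall x y y', resolvent eta T x y -> resolvent eta T x y' -> y = y'.

End Operators.

Section Scheme.
Context {R : realType} {p : nat}.
Local Notation V := 'rV[R]_p.

(* The values with index -1 only enter the term F y^{-1} of hat w^0, which the
   recursion never uses, so all the sequences start at index 0. *)
Record gaeg (F : V -> V) (T : V -> set V) (eta lambda : R)
    (gamma theta nu : nat -> R) (x hx y xi u : nat -> V) : Prop := Gaeg {
  gaeg_x0 : sv_dom (sv_sum F T) (x 0%N);
  gaeg_xi0 : T (x 0%N) (xi 0%N);
  gaeg_u0 : u 0%N = F (x 0%N);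
  gaeg_hx0 : hx 0%N = x 0%N;
  gaeg_y0 : y 0%N = hx 0%N;
  gaeg_xS : forall k,
    resolvent eta T
      (y k - eta *: (F (y k) - gamma k *: (u k + xi k))) (x k.+1);
  gaeg_xiS : forall k,
    xi k.+1 = eta^-1 *: (y k - x k.+1) - F (y k) + gamma k *: (u k + xi k);
  gaeg_hxS : forall k, hx k.+1 = x k.+1 - lambda *: (u k.+1 + xi k.+1);
  gaeg_yS : forall k,
    y k.+1 = hx k.+1 + theta k *: (hx k.+1 - hx k) + nu k *: (y k - hx k.+1)
}.

Section Consequences.
Variables (F : V -> V) (T : V -> set V) (eta lambda : R).
Variables (gamma theta nu : nat -> R) (x hx y xi u : nat -> V).
Hypothesis G : gaeg F T eta lambda gamma theta nu x hx y xi u.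
Hypothesis eta0 : eta != 0.

Lemma gaeg_xi k : T (x k) (xi k).
Proof.
case: k => [|k]; first exact: (gaeg_xi0 G).
have [v Tv /eqP] := gaeg_xS G k.
set B := F (y k) - _; rewrite subr_eq => /eqP yE.
suff -> : xi k.+1 = v by [].
have dE : y k - x k.+1 = eta *: (v + B).
  by rewrite scalerDr yE addrC !addrA addNr add0r.
rewrite (gaeg_xiS G) dE scalerA mulVf // scale1r.
by rewrite -addrA [- F _ + _]addrC -(opprB (F (y k))) addrK.
Qed.

(* hat w^{k+1} = F y^k + xi^{k+1} *)
Lemma gaeg_implicit k :
  x k.+1 = y k - eta *: (F (y k) + xi k.+1 - gamma k *: (u k + xi k)).
Proof.
rewrite (gaeg_xiS G).
set g := gamma k *: _; set f := F _; set d := eta^-1 *: _.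
have -> : f + (d - f + g) - g = d by rewrite addrA addrK addrC subrK.
by rewrite scalerA divff // scale1r opprB addrC subrK.
Qed.

End Consequences.
End Scheme.

Section Constants.
Context {R : realType}.
Implicit Types L rho kappa lambda r : R.

Definition sigma : R := 5 / 24.

Definition bar_b rho kappa : R :=
  (1 + sigma) * (49 * kappa + 8) * rho / (29 * kappa + 4).

Definition bar_c L rho kappa : R :=
  (1 - 32 * (1 + sigma) ^+ 2 * (5 * kappa + 1) * L ^+ 2 * rho ^+ 2)
  / (8 * L ^+ 2 * (29 * kappa + 4)).

Definition bar_lambda L rho kappa : R :=
  2 * bar_c L rho kappa
  / (bar_b rho kappa
     + Num.sqrt (bar_b rho kappa ^+ 2 + 4 * bar_c L rho kappa)).

End Constants.

(* Main.v *)
Require Import Defs.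
From mathcomp Require Import all_boot all_order all_algebra.
From mathcomp Require Import mathcomp_extra boolp classical_sets reals.
From mathcomp Require Import ring lra.

Set Implicit Arguments.
Unset Strict Implicit.
Unset Printing Implicit Defensive.

Import Order.TTheory GRing.Theory Num.Theory.
Local Open Scope classical_set_scope.
Local Open Scope ring_scope.

(** Write [w k = F (x k) + xi k], [e k = u k - F (x k)],
    [d k = F (y k) - F (x k.+1)], [s = t k - 1].  With these parameters
    Nesterov's momentum is Halpern's anchoring in disguise: the point
    [t k *: (y k - hx k) + hx k] does not move ([anchor_invariant]), so [y k] is
    a convex combination of [hx k] and [x 0].
    Multiplying the monotonicity inequality between two successive iterates by
    [s * (s + 1)] therefore telescopes, and, with [X = x k - x 0] and
    [b = 29 / 24 * rho], the quantity

      energy = s (lambda (s + 3) / 2 + b) |w|^2 + s <w, X>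

    decreases, up to the errors [e] and [d], by multiples of
    [|(s + 1) w' - s w|^2] and of [s (s + 1) |w' - w|^2].

    The error [d] is controlled by the Lipschitz continuity of [F], with
    constant [(L * eta) ^+ 2], and the error [e] by the hypothesis on [u].
    Adding [alpha * |s e|^2] to the energy turns the latter bound into a
    telescoping one.  The rest is a quadratic form in [(s + 1) w' - s w],
    [s e] and [(s + 1) d], which is nonpositive ([error_absorption]) when
    [lambda] is at most the positive root of a quadratic equation
    ([bar_lambda_quad]).

    The first step does not fit the pattern, since [hx 0 = x 0] instead of
    [x 0 - lambda *: w 0].  It may raise the energy, though at most to three
    times its initial value.  This factor is harmless: the passage from the
    energy to the residual ([residual_of_energy]) tolerates it, because the
    initial energy is nonnegative. *)

(** * Euclidean inner product *)

Lemma innerC (R : realType) (p : nat) (v w : 'rV[R]_p) : inner v w = inner w v.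
Proof. by apply: eq_bigr => i _; rewrite mulrC. Qed.

Lemma innerDl (R : realType) (p : nat) (u v w : 'rV[R]_p) :
  inner (u + v) w = inner u w + inner v w.
Proof. by rewrite -big_split; apply: eq_bigr => i _; rewrite mxE mulrDl. Qed.

Lemma innerZl (R : realType) (p : nat) (a : R) (v w : 'rV[R]_p) :
  inner (a *: v) w = a * inner v w.
Proof. by rewrite mulr_sumr; apply: eq_bigr => i _; rewrite mxE mulrA. Qed.

Lemma innerNl (R : realType) (p : nat) (v w : 'rV[R]_p) :
  inner (- v) w = - inner v w.
Proof. by rewrite -scaleN1r innerZl mulN1r. Qed.

Lemma innerDr (R : realType) (p : nat) (u v w : 'rV[R]_p) :
  inner w (u + v) = inner w u + inner w v.
Proof. by rewrite !(innerC w) innerDl. Qed.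

Lemma innerZr (R : realType) (p : nat) (a : R) (v w : 'rV[R]_p) :
  inner w (a *: v) = a * inner w v.
Proof. by rewrite !(innerC w) innerZl. Qed.

Lemma innerNr (R : realType) (p : nat) (v w : 'rV[R]_p) :
  inner w (- v) = - inner w v.
Proof. by rewrite !(innerC w) innerNl. Qed.

Lemma inner0r (R : realType) (p : nat) (w : 'rV[R]_p) : inner w 0 = 0.
Proof. by rewrite -(scale0r w) innerZr mul0r. Qed.

Definition innerE := (innerDl, innerDr, innerNl, innerNr, innerZl, innerZr).

Lemma inner_ge0 (R : realType) (p : nat) (v : 'rV[R]_p) : 0 <= inner v v.
Proof. by apply: sumr_ge0 => i _; rewrite -expr2 sqr_ge0. Qed.

Lemma enorm_sq (R : realType) (p : nat) (v : 'rV[R]_p) :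
  enorm v ^+ 2 = inner v v.
Proof. by rewrite sqr_sqrtr // inner_ge0. Qed.

Lemma enorm_ge0 (R : realType) (p : nat) (v : 'rV[R]_p) : 0 <= enorm v.
Proof. exact: sqrtr_ge0. Qed.

Lemma lipschitz_sq (R : realType) (p : nat) (F : 'rV[R]_p -> 'rV[R]_p) (L : R)
    (v w : 'rV[R]_p) : lipschitz_with L F ->
  inner (F v - F w) (F v - F w) <= L ^+ 2 * inner (v - w) (v - w).
Proof.
move=> /(_ v w) h; rewrite -!enorm_sq -exprMn; apply: lerXn2r => //;
  rewrite nnegrE ?enorm_ge0 //; exact: le_trans (enorm_ge0 _) h.
Qed.

(** * The conditions on the step size *)

(** The threshold [bar_lambda] is the positive root of
    [l ^+ 2 + bar_b * l - bar_c], written with the square root in the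
    denominator.  Once the denominators are cleared, the quadratic factors, and
    one factor is a quarter of the step size [eta].  Positivity of [bar_c]
    follows from that of [lambda]. *)
Lemma bar_lambda_quad (R : realType) (L rho kappa lambda : R) :
  0 < L -> 0 <= rho -> 0 <= kappa ->
  0 < lambda -> lambda <= bar_lambda L rho kappa ->
  8 * L ^+ 2 * ((lambda + 29 / 24 * rho)
    * ((29 * kappa + 4) * lambda + (20 * kappa + 4) * (29 / 24 * rho))) <= 1.
Proof.
move=> L0 rho0 k0 l0; rewrite /bar_lambda.
set b := bar_b _ _; set c := bar_c _ _ _; set s := Num.sqrt _ => hl.
have A0 : 0 < 29 * kappa + 4 by lra.
have b0 : 0 <= b.
  rewrite /b /bar_b /sigma; apply: divr_ge0; last exact: ltW.
  by apply: mulr_ge0 => //; apply: mulr_ge0; lra.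
have s0 : 0 <= s by exact: sqrtr_ge0.
have den0 : 0 < b + s.
  rewrite lt_neqAle eq_sym addr_ge0 // andbT; apply/eqP => h0.
  by move: hl; rewrite h0 invr0 mulr0 leNgt l0.
have hc : lambda * (b + s) <= 2 * c by rewrite -ler_pdivlMr.
have c0 : 0 < c by have := mulr_gt0 l0 den0; lra.
have sE : s ^+ 2 = b ^+ 2 + 4 * c.
  by rewrite sqr_sqrtr // addr_ge0 ?sqr_ge0 //; lra.
have hs : 2 * lambda + b <= s.
  by rewrite -(ler_pM2r den0); nra.
have quad : lambda ^+ 2 + b * lambda <= c by nra.
have L20 : 0 < L ^+ 2 by rewrite exprn_gt0.
have e1 : (29 * kappa + 4) * b = 29 / 24 * rho * (49 * kappa + 8).
  by rewrite /b /bar_b /sigma; field; rewrite gt_eqF.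
have e2 : 8 * L ^+ 2 * (29 * kappa + 4) * c
    = 1 - 32 * (29 / 24 * rho) ^+ 2 * (5 * kappa + 1) * L ^+ 2.
  by rewrite /c /bar_c /sigma; field; rewrite !gt_eqF.
have m0 : 0 <= 8 * L ^+ 2 * (29 * kappa + 4) by rewrite !mulr_ge0 // ltW.
have := ler_wpM2l m0 quad; rewrite e2.
have -> : 8 * L ^+ 2 * (29 * kappa + 4) * (lambda ^+ 2 + b * lambda)
    = 8 * L ^+ 2 * ((29 * kappa + 4) * lambda ^+ 2
                    + lambda * (29 / 24 * rho * (49 * kappa + 8))).
  by rewrite -e1; ring.
by lra.
Qed.

(** * Decrease of the energy *)

(** In the application [q = (s + 1) w' - s w], [S = s e], [D = (s + 1) d], and
    [c] is the multiplier of the Lipschitz bound times its constant.  At the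
    extreme value of [c] the form is minus a sum of squares, once the parts in
    [a] and in [b] are separated; the squares are best found in the variables
    [q + D], [D], [S] and [q + D], [q], [S], respectively.  The summand
    [1 / 4 * a] in the coefficient of [inner q q] is a reserve that pays for the
    irregular first step. *)
Lemma error_absorption (R : realType) (p : nat) (a b c : R) (q S D : 'rV[R]_p) :
  0 <= a -> 0 <= b -> c <= 4 / 3 * (a + b) ->
  - (2 * a + 3 * b) * inner q q + 1 / 4 * a * inner q q + (3 * a + 4 * b) * inner q S
    - 4 * (a + b) * inner q D - (58 / 3 * a + 10 * b) * inner S S
    - (8 / 3 * a + 2 * b) * inner D D + c * inner (q + D - S) (q + D - S) <= 0.
Proof.
move=> a0 b0 hc.
have h0 := ler_wpM2r (inner_ge0 (q + D - S)) hc.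
have h1 := mulr_ge0 a0 (inner_ge0 (q + D - S)).
have h2 := mulr_ge0 a0 (inner_ge0 (D + 9 *: S)).
have h7 := mulr_ge0 a0 (inner_ge0 (q + 2 *: D)).
have h3 := mulr_ge0 b0 (inner_ge0 (q + D + 2 *: S)).
have h4 := mulr_ge0 b0 (inner_ge0 (q - 2 *: S)).
have h5 := mulr_ge0 a0 (inner_ge0 S).
have h6 := mulr_ge0 b0 (inner_ge0 S).
move: h0 h1 h2 h3 h4 h5 h6 h7.
rewrite !innerE (innerC D q) (innerC S q) (innerC S D).
nra.
Qed.

(** The Lyapunov function of the anchored iteration, at [X = x k - x 0] and
    [s = t k - 1]. *)
Definition energy (R : realType) (p : nat) (lambda b s : R) (w X : 'rV[R]_p) : R :=
  s * (lambda * (s + 3) / 2 + b) * inner w w + s * inner w X.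

(** Pairing the update with [w] and with [w'] turns [s * (s + 1)] times the
    monotonicity inequality into the difference of the two terms [s <w, X>];
    the identity
    [|q|^2 = s (s + 1) |w' - w|^2 + (s + 1) |w'|^2 - s |w|^2] produces the
    squared norms of the energy, and [error_absorption] handles the error terms.
    The weight [alpha] is such that [alpha / 58] is at most the gain per
    [s (s + 1) |w' - w|^2].  The Lipschitz bound is used with the multiplier [m],
    which keeps [alpha * kappa * |(s + 1) d|^2] for the next step; the condition
    on the step size is what gives [m * M <= 4 / 3 * h].  The vector [g]
    measures the failure of [hx = x - lambda *: z]: it is [w] at the first step
    and [0] afterwards. *)
Lemma energy_descent (R : realType) (p : nat)
    (lambda rho kappa M s : R) (w w' e d g X X' : 'rV[R]_p) :
  let b := 29 / 24 * rho in
  let h := lambda + b in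
  let alpha := 58 / 3 * lambda + 10 * b in
  let q := (s + 1) *: w' - s *: w in
  0 <= lambda -> 0 <= rho -> 0 <= kappa -> 0 <= M -> 0 < s ->
  (s + 1) *: X' = s *: X + (s * (4 * h - lambda)) *: (w + e) + (s * lambda) *: g
                  - ((s + 1) * (4 * h)) *: (w' + d) ->
  - rho * inner (w' - w) (w' - w) <= inner (w' - w) (X' - X) ->
  inner ((s + 1) *: d) ((s + 1) *: d)
    <= M * inner (q + (s + 1) *: d - s *: e) (q + (s + 1) *: d - s *: e) ->
  M * ((29 * kappa + 4) * lambda + (20 * kappa + 4) * b) <= 2 * h ->
  energy lambda b (s + 1) w' X'
    + alpha * (kappa * inner ((s + 1) *: d) ((s + 1) *: d)
               + 58^-1 * (s * (s + 1)) * inner (w' - w) (w' - w))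
  <= energy lambda b s w X + alpha * inner (s *: e) (s *: e)
     + lambda * s ^+ 2 * inner g g.
Proof.
move=> b h alpha q l0 rho0 k0 M0 s0 upd mono lip hM.
have b0 : 0 <= b by rewrite /b; lra.
pose m := kappa * alpha + 8 / 3 * lambda + 2 * b.
have m0 : 0 <= m by rewrite /m /alpha; nra.
have cle : m * M <= 4 / 3 * h.
  have := mulr_ge0 (mulr_ge0 k0 b0) M0; have := mulr_ge0 M0 b0.
  by move: hM; rewrite /m /alpha; lra.
have abs := error_absorption q (s *: e) ((s + 1) *: d) l0 b0 cle.
have lipm := ler_wpM2l m0 lip.
have st0 : 0 <= s * (s + 1) by nra.
have monos := ler_wpM2l st0 mono.
have P := congr1 (fun v => inner w v) upd.
have P' := congr1 (fun v => inner w' v) upd.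
(* Young's inequality for the term lambda * s * <q, g>. *)
have defect := mulr_ge0 l0 (inner_ge0 ((1 / 2) *: q - s *: g)).
have gain := mulr_ge0 (mulr_ge0 l0 st0) (inner_ge0 (w' - w)).
move: P P' => /= /(congr1 (fun z => s * z)) P /(congr1 (fun z => (s + 1) * z)) P'.
move: P P' monos gain abs lipm defect {upd mono lip hM cle m0 st0}.
rewrite /m /alpha /energy /q /h /b !innerE (innerC w' w) (innerC d w) (innerC e w)
  (innerC e w') (innerC d w') (innerC d e)
  (innerC g w) (innerC g w').
move: (inner w w) (inner w w') (inner w' w') (inner w e) (inner w' e) (inner w d)
  (inner w' d) (inner e d) (inner e e) (inner d d) (inner w X) (inner w' X)
  (inner w X') (inner w' X') (inner w g) (inner w' g) (inner g g).
move=> ? ? ? ? ? ? ? ? ? ? ? ? ? ? ? ? ? P P' monos gain abs lipm defect.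
lra.
Qed.

(** * From the energy to the residual *)

(** The term [<w, X>] is bounded below by monotonicity at the pair [w], [0] and
    the square [|lambda s w - 4 v|^2], where [v = x 0 - xstar].  With the
    factor 3 in the bound on the energy, the terms in [s ^+ 2] leave exactly
    this square: [1 / 2 / 3 - 1 / 8 = 1 / 24]. *)
Lemma residual_of_energy (R : realType) (p : nat) (lambda rho b s E : R)
    (w X v : 'rV[R]_p) :
  0 < lambda -> 0 < s -> rho <= b ->
  - rho * inner w w <= inner w (X + v) ->
  energy lambda b s w X <= 3 * E ->
  3 * lambda ^+ 2 * s * (s + 3) * inner w w
    <= 24 * lambda * E + 16 * inner v v.
Proof.
move=> l0 s0 rb mono hE.
have sq := inner_ge0 (lambda * s *: w - 4 *: v).
have ls0 : 0 <= lambda * s by rewrite mulr_ge0 ?ltW.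
have monos := ler_wpM2l ls0 mono.
have rbs : 0 <= lambda * s * inner w w * (b - rho).
  by rewrite !mulr_ge0 ?inner_ge0 ?subr_ge0 // ltW.
have lls : 0 <= lambda ^+ 2 * s * inner w w.
  by rewrite !mulr_ge0 ?inner_ge0 ?exprn_ge0 // ltW.
have hEl := ler_wpM2l (ltW l0) hE.
move: sq monos rbs lls hEl; rewrite /energy !innerE (innerC v w).
by lra.
Qed.

(** * The scheme *)

(** Multiplied by [t k.+1], the momentum update contains [t k - 1] copies of
    [hx k.+1 - hx k] and [t k] copies of [y k - hx k.+1], so that all but one
    copy of [hx k.+1] cancel. *)
Lemma anchor_invariant (R : realType) (p : nat) (F : 'rV[R]_p -> 'rV[R]_p)
    (T : 'rV[R]_p -> set 'rV[R]_p) (eta lambda : R) (t gamma theta nu : nat -> R)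
    (x hx y xi u : nat -> 'rV[R]_p) :
  gaeg F T eta lambda gamma theta nu x hx y xi u ->
  (forall k, t k != 0) ->
  (forall k, theta k = (t k - 1) / t k.+1) ->
  (forall k, nu k = t k / t k.+1) ->
  forall k, t k *: (y k - hx k) + hx k = x 0%N.
Proof.
move=> G t0 thetaE nuE; elim=> [|k <-].
  by rewrite (gaeg_y0 G) subrr scaler0 add0r (gaeg_hx0 G).
rewrite (gaeg_yS G) thetaE nuE; apply/rowP => i; rewrite !mxE.
by field.
Qed.

Theorem theorem6p1 (R : realType) (p : nat)
  (F : 'rV[R]_p -> 'rV[R]_p) (T : 'rV[R]_p -> set 'rV[R]_p)
  (L rho kappa hkappa r lambda eta : R)
  (t gamma theta nu : nat -> R)
  (x hx y xi u : nat -> 'rV[R]_p)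
  (zer_neq0 : zer (sv_sum F T) !=set0)
  (L_gt0 : 0 < L)
  (F_lip : lipschitz_with L F)
  (rho_ge0 : 0 <= rho)
  (Phi_cohypo : co_hypomonotone rho (sv_sum F T))
  (J_wd : resolvent_well_defined eta T)
  (scheme : gaeg F T eta lambda gamma theta nu x hx y xi u)
  (kappa_ge0 : 0 <= kappa)
  (hkappa_ge0 : 0 <= hkappa)
  (u_approx : forall k : nat, (1 <= k)%N ->
     enorm (F (x k) - u k) ^+ 2
       <= kappa * enorm (F (x k) - F (y k.-1)) ^+ 2
          + hkappa * enorm ((F (x k) + xi k)
                            - (F (x k.-1) + xi k.-1)) ^+ 2)
  (r_gt1 : 1 < r)
  (hkappa_le : hkappa <= (r - 1) / (58 * r))
  (Lrho_lt : L * rho < 6 / (29 * Num.sqrt (2 * (5 * kappa + 1))))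
  (lambda_gt0 : 0 < lambda)
  (lambda_le : lambda <= bar_lambda L rho kappa)
  (etaE : eta = 4 * lambda + 29 / 6 * rho)
  (tE : forall k : nat, t k = k%:R + r)
  (gammaE : forall k : nat, gamma k = (t k - 1) / t k)
  (thetaE : forall k : nat, theta k = (t k - 1) / t k.+1)
  (nuE : forall k : nat, nu k = t k / t k.+1) :
  forall (xstar : 'rV[R]_p), zer (sv_sum F T) xstar ->
  let R0sq := lambda * (r - 1) * (12 * (r + 2) * lambda + 29 * rho)
                * enorm (F (x 0%N) + xi 0%N) ^+ 2
              + 16 * enorm (x 0%N - xstar) ^+ 2 in
  forall k : nat,
    enorm (F (x k) + xi k) ^+ 2
      <= R0sq / (3 * lambda ^+ 2 * (k%:R + r - 1) * (k%:R + r + 2)).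
Proof.
move=> xstar zstar R0sq k.
set b := 29 / 24 * rho; set h := lambda + b.
have b0 : 0 <= b by rewrite /b; lra.
have h0 : 0 < h by rewrite /h; lra.
have eta4 : eta = 4 * h by rewrite etaE /h /b; field.
have eta0 : eta != 0 by rewrite eta4 gt_eqF // mulr_gt0.
pose w j : 'rV[R]_p := F (x j) + xi j.
pose e j : 'rV[R]_p := u j - F (x j).
pose d j : 'rV[R]_p := F (y j) - F (x j.+1).
pose X j : 'rV[R]_p := x j - x 0%N.
pose g (j : nat) : 'rV[R]_p := if j is 0%N then w 0%N else 0.
pose s j : R := j%:R + r - 1.
pose alpha := 58 / 3 * lambda + 10 * b.
pose M := L ^+ 2 * eta ^+ 2.
have alpha0 : 0 <= alpha by rewrite /alpha; lra.
have M0 : 0 <= M by rewrite mulr_ge0 ?sqr_ge0.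
have n0 j : 0 <= j%:R :> R by [].
have s0 j : 0 < s j by have := n0 j; rewrite /s; lra.
have tS j : t j = s j + 1 by rewrite tE /s; ring.
have tn0 j : t j != 0 by rewrite tS gt_eqF //; have := s0 j; lra.
have sS j : s j.+1 = s j + 1 by rewrite /s -natr1; ring.
have Phiw j : sv_sum F T (x j) (w j).
  by exists (xi j) => //; exact: (gaeg_xi scheme eta0).
have hM : M * ((29 * kappa + 4) * lambda + (20 * kappa + 4) * b) <= 2 * h.
  have := bar_lambda_quad L_gt0 rho_ge0 kappa_ge0 lambda_gt0 lambda_le.
  rewrite -/b -/h => /(ler_wpM2l (ltW h0)).
  by rewrite /M eta4; lra.
have hxE j : hx j = x j - lambda *: (w j + e j) + lambda *: g j.
  case: j => [|j] /=.
    by rewrite (gaeg_hx0 scheme) /e (gaeg_u0 scheme) subrr addr0 subrK.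
  rewrite scaler0 addr0 (gaeg_hxS scheme) /w /e.
  by rewrite [_ + xi _ + _]addrC addrA subrK.
have yE j : y j - x j.+1
    = eta *: (F (y j) + xi j.+1 - gamma j *: (u j + xi j)).
  by rewrite [in LHS](gaeg_implicit scheme eta0) opprB addrC subrK.
have step j : energy lambda b (s j.+1) (w j.+1) (X j.+1)
      + alpha * inner (s j.+1 *: e j.+1) (s j.+1 *: e j.+1)
    <= energy lambda b (s j) (w j) (X j) + alpha * inner (s j *: e j) (s j *: e j)
       + lambda * s j ^+ 2 * inner (g j) (g j).
  have upd : (s j + 1) *: X j.+1 = s j *: X j
      + (s j * (4 * h - lambda)) *: (w j + e j) + (s j * lambda) *: g j
      - ((s j + 1) * (4 * h)) *: (w j.+1 + d j).
    have A := anchor_invariant scheme tn0 thetaE nuE j.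
    have Y := yE j; have H := hxE j.
    have sgam : (s j + 1) * gamma j = s j by rewrite gammaE -tS mulrC divfK // tS addrK.
    apply/rowP => i.
    move: (congr1 (fun v : 'rV[R]_p => v 0 i) A) (congr1 (fun v : 'rV[R]_p => v 0 i) Y)
          (congr1 (fun v : 'rV[R]_p => v 0 i) H).
    rewrite -eta4 tS /X /w /e /d !mxE => A_i /(congr1 ( *%R (s j + 1))) Y_i.
    move=> /(congr1 ( *%R (s j))) H_i.
    have := congr1 ( *%R^~ (eta * (u j 0 i + xi j 0 i))) sgam.
    by move: A_i Y_i H_i => /=; lra.
  have mono : - rho * inner (w j.+1 - w j) (w j.+1 - w j)
      <= inner (w j.+1 - w j) (X j.+1 - X j).
    have := Phi_cohypo _ _ _ _ (Phiw j.+1) (Phiw j).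
    by rewrite enorm_sq /X opprB addrA subrK.
  have lip : inner ((s j + 1) *: d j) ((s j + 1) *: d j)
      <= M * inner ((s j + 1) *: w j.+1 - s j *: w j + (s j + 1) *: d j - s j *: e j)
                   ((s j + 1) *: w j.+1 - s j *: w j + (s j + 1) *: d j - s j *: e j).
    have -> : (s j + 1) *: w j.+1 - s j *: w j + (s j + 1) *: d j - s j *: e j
        = (s j + 1) *: (F (y j) + xi j.+1 - gamma j *: (u j + xi j)).
      have t0 : s j + 1 != 0 by rewrite -tS.
      by apply/rowP => i; rewrite gammaE tS /w /d /e !mxE; field.
    have := lipschitz_sq (y j) (x j.+1) F_lip; rewrite yE -/(d j) !innerE => hl.
    have := ler_wpM2l (sqr_ge0 (s j + 1)) hl.
    by rewrite /M; lra.
  have := energy_descent (ltW lambda_gt0) rho_ge0 kappa_ge0 M0 (s0 j) upd mono lip hM.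
  rewrite -/b -/alpha; apply: le_trans.
  rewrite sS lerD2l; apply: ler_wpM2l => //.
  have := u_approx j.+1 isT; rewrite /= !enorm_sq -/(w j) -/(w j.+1).
  rewrite -(opprB (u j.+1)) -(opprB (F (y j))) -/(e j.+1) -/(d j) => ua.
  have := ler_wpM2l (sqr_ge0 (s j + 1)) ua.
  (* Since [t k / s k] is largest at [k = 0], where it is [r / (r - 1)]. *)
  have hk : hkappa * (s j + 1) <= 58^-1 * s j.
    have r0 : 0 < 58 * r by lra.
    move: hkappa_le; rewrite ler_pdivlMr // => hr.
    have hk1 : 0 <= 1 - 58 * hkappa.
      by rewrite -(pmulr_rge0 _ (lt_trans ltr01 r_gt1)); lra.
    have := mulr_ge0 (n0 j) hk1.
    by rewrite /s; lra.
  have st0 : 0 <= (s j + 1) * inner (w j.+1 - w j) (w j.+1 - w j).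
    by rewrite mulr_ge0 ?inner_ge0 //; have := s0 j; lra.
  have := ler_wpM2r st0 hk.
  move: (inner (w j.+1 - w j) _) => dw; rewrite !innerE; lra.
pose E := energy lambda b (s 0%N) (w 0%N) (X 0%N).
have EE : E = s 0%N * (lambda * (s 0%N + 3) / 2 + b) * inner (w 0%N) (w 0%N).
  by rewrite /E /energy /X subrr inner0r mulr0 addr0.
have w00 := inner_ge0 (w 0%N).
(* The left-hand side is what the irregular first step adds to the energy. *)
have E0 : lambda * s 0%N ^+ 2 * inner (w 0%N) (w 0%N) <= 2 * E.
  have := mulr_ge0 (mulr_ge0 (ltW lambda_gt0) (ltW (s0 0%N))) w00.
  have := mulr_ge0 (mulr_ge0 b0 (ltW (s0 0%N))) w00.
  by rewrite EE; lra.
have Epos : 0 <= E.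
  suff: 0 <= lambda * s 0%N ^+ 2 * inner (w 0%N) (w 0%N) by lra.
  by rewrite !mulr_ge0 ?sqr_ge0 // ltW.
have e0 : e 0%N = 0 by rewrite /e (gaeg_u0 scheme) subrr.
have V j : energy lambda b (s j.+1) (w j.+1) (X j.+1)
      + alpha * inner (s j.+1 *: e j.+1) (s j.+1 *: e j.+1) <= 3 * E.
  elim: j => [|j IH].
    have := step 0%N; rewrite -/E e0 scaler0 inner0r.
    by rewrite [g _]/=; lra.
  by have := step j.+1; rewrite [g _]/= inner0r; lra.
have Ek : energy lambda b (s k) (w k) (X k) <= 3 * E.
  case: k => [|k]; first by rewrite -/E; lra.
  have := V k; have := mulr_ge0 alpha0 (inner_ge0 (s k.+1 *: e k.+1)); lra.
have mono : - rho * inner (w k) (w k) <= inner (w k) (X k + (x 0%N - xstar)).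
  have := Phi_cohypo _ _ _ _ (Phiw k) zstar.
  by rewrite subr0 enorm_sq /X addrA subrK.
have rb : rho <= b by rewrite /b; lra.
have := residual_of_energy lambda_gt0 (s0 k) rb mono Ek.
rewrite /R0sq !enorm_sq -/(w 0%N) -/(w k) EE => fin.
have sk : s k = k%:R + r - 1 by [].
have sk3 : k%:R + r + 2 = s k + 3 by rewrite sk; ring.
rewrite -sk sk3 ler_pdivlMr; last first.
  by rewrite !mulr_gt0 ?exprn_gt0 //; have := s0 k; lra.
move: fin; rewrite /b [s 0%N]/s; lra.
Qed.
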